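(* For $n\geqslant 1$, define $$B_n^{(A)}(x,y,s,t,p,q)=\sum_{\sigma\in\mathcal{S}^B_n}x^{\mathrm{exc}_A(\sigma)}y^{\mathrm{aexc}_A(\sigma)}s^{\mathrm{single}(\sigma)}t^{\mathrm{fix}(\sigma)}p^{\mathrm{neg}(\sigma)}q^{\mathrm{cyc}(\sigma)}.$$ Then $$B_n^{(A)}(x,y,s,t,p,q)=\sum_{\pi\in\mathcal{S}_n}(x+py)^{\mathrm{exc}(\pi)}(y+py)^{\mathrm{drop}(\pi)}(t+sp)^{\mathrm{fix}(\pi)}q^{\mathrm{cyc}(\pi)},$$ equivalently $$B_n^{(A)}(x,y,s,t,p,q)=(1+p)^ny^nA_n\left(\frac{x+py}{y+py},\frac{t+sp}{y+py},q\right),$$ where $A_n(x,p,q)=\sum_{\pi\in\mathcal{S}_n}x^{\mathrm{exc}(\pi)}p^{\mathrm{fix}(\pi)}q^{\mathrm{cyc}(\pi)}$.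
   Context: $\mathcal{S}^B_n$ is the group of bijections $\sigma$ of $\{\pm1,\dots,\pm n\}$ with $\sigma(-i)=-\sigma(i)$. For $\sigma\in\mathcal{S}^B_n$: $\mathrm{exc}_A(\sigma)=\#\{i\in[n]:\sigma(i)>i\}$ (integer comparison), $\mathrm{fix}(\sigma)=\#\{i:\sigma(i)=i\}$, $\mathrm{single}(\sigma)=\#\{i:\sigma(i)=-i\}$, $\mathrm{neg}(\sigma)=\#\{i:\sigma(i)<0\}$, $\mathrm{aexc}_A(\sigma)=n-\mathrm{exc}_A(\sigma)-\mathrm{fix}(\sigma)-\mathrm{single}(\sigma)$, and $\mathrm{cyc}(\sigma)$ is the number of cycles of the permutation $i\mapsto|\sigma(i)|$ of $[n]$. For $\pi\in\mathcal{S}_n$: $\mathrm{exc}(\pi)=\#\{i:\pi(i)>i\}$, $\mathrm{drop}(\pi)=\#\{i:\pi(i)<i\}$, $\mathrm{fix}(\pi)=\#\{i:\pi(i)=i\}$, $\mathrm{cyc}(\pi)$ the number of cycles. *)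

(* Defs.v *)
From HB Require Import structures.
From mathcomp Require Import all_boot all_order all_algebra all_fingroup.

Set Implicit Arguments.
Unset Strict Implicit.
Unset Printing Implicit Defensive.

Import Order.TTheory GRing.Theory Num.Theory.

Local Open Scope ring_scope.

(* The letter (b, i) stands for the integer i + 1 if b = false and for        *)
(* - (i + 1) if b = true, so that letter n is {±1, ..., ±n}; [n] is 'I_n,     *)
(* shifted by one.                                                            *)
Definition letter (n : nat) : finType := (bool * 'I_n)%type.

Definition letter_int (n : nat) (a : letter n) : int :=
  (-1) ^+ a.1 * (a.2.+1)%:Z.

Definition letter_opp (n : nat) (a : letter n) : letter n := (~~ a.1, a.2).

Definition letter_pos (n : nat) (i : 'I_n) : letter n := (false, i).

Definition letter_abs (n : nat) (a : letter n) : 'I_n := a.2.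

Lemma letter_int_inj (n : nat) : injective (@letter_int n).
Proof.
move=> [[] i] [[] j]; rewrite /letter_int /= ?expr1 ?expr0 ?mulN1r ?mul1r.
- by move=> /oppr_inj [/val_inj ->].
- by [].
- by [].
- by case=> /val_inj ->.
Qed.

Lemma letter_int_opp (n : nat) (a : letter n) :
  letter_int (letter_opp a) = - letter_int a.
Proof. by case: a => [[] i]; rewrite /letter_int /= ?mulN1r ?mul1r ?opprK. Qed.

Definition odd_sym (n : nat) (f : {perm letter n}) : bool :=
  [forall a, f (letter_opp a) == letter_opp (f a)].

Definition signed_perm (n : nat) : finType := {f : {perm letter n} | odd_sym f}.

Definition sp_app (n : nat) (sigma : signed_perm n) (i : 'I_n) : letter n :=
  val sigma (letter_pos i).

Lemma sp_abs_inj (n : nat) (sigma : signed_perm n) :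
  injective (fun i => letter_abs (sp_app sigma i)).
Proof.
case: sigma => f fN i j; rewrite /letter_abs /sp_app /= => eq2.
have [eq1 | ne1] := eqVneq (f (letter_pos i)).1 (f (letter_pos j)).1.
  suff /perm_inj [] : f (letter_pos i) = f (letter_pos j) by [].
  by rewrite [LHS]surjective_pairing [RHS]surjective_pairing eq1 eq2.
suff : f (letter_pos i) = f (letter_opp (letter_pos j)) by move/perm_inj.
rewrite (eqP (forallP fN _)) [LHS]surjective_pairing /letter_opp eq2.
by congr (_, _); move: ne1; case: (_.1); case: (_.1).
Qed.

Definition sp_abs (n : nat) (sigma : signed_perm n) : 'S_n :=
  perm (@sp_abs_inj n sigma).

Definition excA (n : nat) (sigma : signed_perm n) : nat :=
  #|[set i | letter_int (letter_pos i) < letter_int (sp_app sigma i)]|.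

Definition fixB (n : nat) (sigma : signed_perm n) : nat :=
  #|[set i | sp_app sigma i == letter_pos i]|.

Definition single (n : nat) (sigma : signed_perm n) : nat :=
  #|[set i | sp_app sigma i == letter_opp (letter_pos i)]|.

Definition neg (n : nat) (sigma : signed_perm n) : nat :=
  #|[set i | letter_int (sp_app sigma i) < 0]|.

(* By excA_fixB_single_le below, the truncated subtractions never truncate.   *)
Definition aexcA (n : nat) (sigma : signed_perm n) : nat :=
  (n - excA sigma - fixB sigma - single sigma)%N.

Lemma excA_fixB_single_le (n : nat) (sigma : signed_perm n) :
  (excA sigma + fixB sigma + single sigma <= n)%N.
Proof.
rewrite /excA /fixB /single; set E := [set i | _]; set F := [set i | _].
set S := [set i | _].
have dEF : [disjoint E & F].
  rewrite -setI_eq0; apply/eqP/setP => i; rewrite !inE.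
  by case: eqP => [->|]; rewrite ?ltxx ?andbF.
have dEFS : [disjoint E :|: F & S].
  rewrite -setI_eq0; apply/eqP/setP => i; rewrite !inE.
  by case: (sp_app sigma i =P letter_opp _) => [->|]; rewrite ?andbF.
rewrite -cardsUI (disjoint_setI0 dEF) cards0 addn0.
rewrite -cardsUI (disjoint_setI0 dEFS) cards0 addn0.
by rewrite -[leqRHS]card_ord max_card.
Qed.

Definition cycB (n : nat) (sigma : signed_perm n) : nat :=
  #|porbits (sp_abs sigma)|.

Definition exc (n : nat) (pi : 'S_n) : nat := #|[set i : 'I_n | (i < pi i)%N]|.

Definition dropp (n : nat) (pi : 'S_n) : nat := #|[set i : 'I_n | (pi i < i)%N]|.

Definition fixp (n : nat) (pi : 'S_n) : nat := #|[set i : 'I_n | pi i == i]|.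

Definition cyc (n : nat) (pi : 'S_n) : nat := #|porbits pi|.

(* Polynomials are given by their values in an arbitrary commutative ring;    *)
(* instantiating the ring with a polynomial ring and the arguments with its   *)
(* indeterminates gives the formal polynomials.                               *)
Definition BA_poly (n : nat) (R : comNzRingType) (x y s t p q : R) : R :=
  \sum_(sigma : signed_perm n)
    x ^+ excA sigma * y ^+ aexcA sigma * s ^+ single sigma
    * t ^+ fixB sigma * p ^+ neg sigma * q ^+ cycB sigma.

Definition A_poly (n : nat) (R : comNzRingType) (x p q : R) : R :=
  \sum_(pi : 'S_n) x ^+ exc pi * p ^+ fixp pi * q ^+ cyc pi.

(* Main.v *)
(* The map sigma |-> (|sigma|, signs of sigma(1), ..., sigma(n)) is a bijection
   from signed permutations onto 'S_n * {ffun 'I_n -> bool}, and the weight of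
   sigma is a product over i of factors depending only on i, |sigma|(i) and the
   sign of sigma(i).  Summing over the n independent signs turns the factor at i
   into (x or y) + p y at an excedance or a drop of |sigma|, and into t + s p at
   a fixed point. *)
Require Import Defs.
From HB Require Import structures.
From mathcomp Require Import all_boot all_order all_algebra all_fingroup.

Set Implicit Arguments.
Unset Strict Implicit.
Unset Printing Implicit Defensive.

Import Order.TTheory GRing.Theory Num.Theory.

Local Open Scope ring_scope.

Lemma letter_int_lt0 (n : nat) (a : letter n) : (letter_int a < 0) = a.1.
Proof. by case: a => [[] i]; rewrite /letter_int /= ?mulN1r ?mul1r. Qed.

Lemma letter_int_pos_lt (n : nat) (i : 'I_n) (a : letter n) :
  (letter_int (letter_pos i) < letter_int a) = ~~ a.1 && (i < a.2)%N.
Proof.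
by case: a => [[] j]; rewrite /letter_int /= ?mulN1r !mul1r.
Qed.

Lemma expr_card_set (R : comNzRingType) (I : finType) (P : pred I) (x : R) :
  x ^+ #|[set i | P i]| = \prod_i (if P i then x else 1).
Proof.
by rewrite -prodr_const big_mkcond; apply: eq_bigr => i _; rewrite inE.
Qed.

Lemma sp_appE (n : nat) (sigma : signed_perm n) (i : 'I_n) :
  sp_app sigma i = ((sp_app sigma i).1, sp_abs sigma i).
Proof. by rewrite permE /letter_abs -surjective_pairing. Qed.

(** The sign of the argument enters through [(+)], so the extension to negative letters is odd by
    construction. *)
Definition perm_with_signs_fun (n : nat) (u : 'S_n * {ffun 'I_n -> bool})
  (a : letter n) : letter n := (a.1 (+) u.2 a.2, u.1 a.2).

Lemma perm_with_signs_fun_inj (n : nat) (u : 'S_n * {ffun 'I_n -> bool}) :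
  injective (perm_with_signs_fun u).
Proof.
by move=> [b i] [c j] [/= eq1 /perm_inj eq2]; move: eq1; rewrite eq2 => /addIb ->.
Qed.

Lemma perm_with_signs_odd (n : nat) (u : 'S_n * {ffun 'I_n -> bool}) :
  odd_sym (perm (@perm_with_signs_fun_inj n u)).
Proof.
by apply/forallP => a; rewrite !permE /perm_with_signs_fun /letter_opp /= addNb.
Qed.

Definition perm_with_signs (n : nat) (u : 'S_n * {ffun 'I_n -> bool}) :
  signed_perm n := Sub (perm _) (perm_with_signs_odd u).

Lemma sp_app_perm_with_signs (n : nat) (u : 'S_n * {ffun 'I_n -> bool}) i :
  sp_app (perm_with_signs u) i = (u.2 i, u.1 i).
Proof. by rewrite /sp_app /= permE. Qed.

Lemma sp_abs_perm_with_signs (n : nat) (u : 'S_n * {ffun 'I_n -> bool}) :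
  sp_abs (perm_with_signs u) = u.1.
Proof. by apply/permP => i; rewrite permE sp_app_perm_with_signs. Qed.

Lemma perm_with_signs_bij (n : nat) : bijective (@perm_with_signs n).
Proof.
exists (fun sigma => (sp_abs sigma, [ffun i => (sp_app sigma i).1])).
  case=> pi f; rewrite sp_abs_perm_with_signs /=; congr (_, _).
  by apply/ffunP => i; rewrite ffunE sp_app_perm_with_signs.
move=> sigma; apply/val_inj/permP => -[b i] /=.
rewrite permE /perm_with_signs_fun /= ffunE.
case: b; last by rewrite -sp_appE.
(* A negative letter is the opposite of a positive one, so oddness reduces this case to
   [sp_app sigma i]. *)
have /forallP/(_ (letter_pos i))/eqP := valP sigma.
by rewrite -/(sp_app sigma i) [in RHS]sp_appE => ->.
Qed.

(** An index off the fixed points of [sp_abs sigma] fails to be an excedance exactly when its image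
    is negative or smaller in absolute value. This set and those counted by [excA], [fixB] and
    [single] thus partition ['I_n]. *)
Lemma aexcAE (n : nat) (sigma : signed_perm n) :
  aexcA sigma = #|[set i | (sp_abs sigma i != i) &&
                           ((sp_app sigma i).1 || (sp_abs sigma i < i)%N)]|.
Proof.
set A := [set i | _].
suff eq_n : (excA sigma + fixB sigma + single sigma + #|A|)%N = n.
  by rewrite /aexcA -!subnDA -[X in (X - _)%N]eq_n addnA addKn.
rewrite -[RHS]card_ord -[RHS]sum1_card /excA /fixB /single.
rewrite -!sum1dep_card !(big_mkcond _ (fun=> 1%N)) -!big_split /=.
apply: eq_bigr => i _.
rewrite letter_int_pos_lt sp_appE /letter_pos /letter_opp !xpair_eqE /=.
(* With equality moved to [nat], one trichotomy decides all four indicators, and exactly one of them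
   is 1. *)
rewrite -(inj_eq val_inj) /=.
by case: (_.1); case: ltngtP.
Qed.

Definition sign_weight (R : comNzRingType) (x y s t p : R) (n : nat)
    (pi : 'S_n) (i : 'I_n) (b : bool) : R :=
  if b then (if pi i == i then s else y) * p
  else if (i < pi i)%N then x else if (pi i < i)%N then y else t.

(** The power of [q] is left out: it depends on [sp_abs sigma] alone and is constant in the sum over
    signs. *)
Lemma BA_term_prod (n : nat) (R : comNzRingType) (x y s t p : R)
    (sigma : signed_perm n) :
  x ^+ excA sigma * y ^+ aexcA sigma * s ^+ single sigma
    * t ^+ fixB sigma * p ^+ neg sigma =
  \prod_i sign_weight x y s t p (sp_abs sigma) i (sp_app sigma i).1.
Proof.
rewrite aexcAE /excA /single /fixB /neg !expr_card_set -!big_split /=.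
apply: eq_bigr => i _.
rewrite letter_int_pos_lt letter_int_lt0 sp_appE.
rewrite /letter_pos /letter_opp !xpair_eqE /sign_weight /=.
rewrite -(inj_eq val_inj) /=.
by case: (_.1); case: ltngtP => _ /=; rewrite ?mulr1 ?mul1r.
Qed.

Lemma exc_drop_fix_prod (n : nat) (R : comNzRingType) (x y t : R) (pi : 'S_n) :
  x ^+ exc pi * y ^+ dropp pi * t ^+ fixp pi =
  \prod_(i < n) (if (i < pi i)%N then x else if (pi i < i)%N then y else t).
Proof.
rewrite !expr_card_set -!big_split; apply: eq_bigr => i _ /=.
by rewrite -(inj_eq val_inj) /=; case: ltngtP; rewrite ?mulr1 ?mul1r.
Qed.

Lemma BA_polyE (n : nat) (R : comNzRingType) (x y s t p q : R) :
  BA_poly n x y s t p q =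
  \sum_(pi : 'S_n)
    (x + p * y) ^+ exc pi * (y + p * y) ^+ dropp pi
    * (t + s * p) ^+ fixp pi * q ^+ cyc pi.
Proof.
rewrite /BA_poly (reindex _ (onW_bij _ (@perm_with_signs_bij n))) /=.
pose F (pi : 'S_n) (f : {ffun 'I_n -> bool}) :=
  (\prod_i sign_weight x y s t p pi i (f i)) * q ^+ cyc pi.
transitivity (\sum_pi \sum_f F pi f).
  rewrite pair_bigA; apply: eq_bigr => u _.
  rewrite BA_term_prod /cycB sp_abs_perm_with_signs; congr (_ * _).
  by apply: eq_bigr => i _; rewrite sp_app_perm_with_signs.
apply: eq_bigr => pi _; rewrite -big_distrl /=; congr (_ * _).
(* Distributivity, read backwards: a sum over all sign functions is a product over [i] of two-term
   sums. *)
rewrite -(bigA_distr_bigA (sign_weight x y s t p pi)) exc_drop_fix_prod.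
apply: eq_bigr => i _; rewrite big_bool /sign_weight -(inj_eq val_inj) /=.
by case: ltngtP => _; rewrite addrC // (mulrC p).
Qed.

Theorem theorem31 (n : nat) (hn : (1 <= n)%N) :
  (forall (R : comNzRingType) (x y s t p q : R),
     BA_poly n x y s t p q =
     \sum_(pi : 'S_n)
       (x + p * y) ^+ exc pi * (y + p * y) ^+ dropp pi
       * (t + s * p) ^+ fixp pi * q ^+ cyc pi)
  /\
  (forall (R : comUnitRingType) (x y s t p q : R),
     y + p * y \is a GRing.unit ->
     BA_poly n x y s t p q =
     (1 + p) ^+ n * y ^+ n
     * A_poly n ((x + p * y) / (y + p * y)) ((t + s * p) / (y + p * y)) q).
Proof.
split=> R x y s t p q; first exact: BA_polyE.
have -> : (1 + p) ^+ n * y ^+ n = (y + p * y) ^+ n.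
  by rewrite -exprMn mulrDl mul1r.
move: (y + p * y) (BA_polyE n x y s t p q) => u -> u_unit.
rewrite /A_poly big_distrr; apply: eq_bigr => pi _ /=.
rewrite [RHS]mulrA; congr (_ * _).
(* Drops get weight 1, as [A_poly] does not record them. *)
have := exc_drop_fix_prod ((x + p * y) / u) 1 ((t + s * p) / u) pi.
rewrite expr1n mulr1 => ->.
(* Each index receives one factor of [u ^+ n]: it cancels the denominator at excedances and fixed
   points, and is the weight itself at drops. *)
rewrite exc_drop_fix_prod -[X in u ^+ X]card_ord -prodr_const -big_split /=.
apply: eq_bigr => i _.
by case: ltngtP => _; rewrite ?mulr1 // [RHS]mulrC divrK.
Qed.
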